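(* Let $\sigma\in\mathcal{P}$ be a fixed permutation, and let $\tau$ be chosen uniformly at random from $\mathcal{S}_n$. Then the probability that $[\sigma,\tau]$ is shellable tends to $0$ as $n$ tends to infinity.
   Context: $\mathcal{S}_n$ is the set of permutations of $\{1,\dots,n\}$ in one-line notation $\tau=\tau_1\tau_2\dots\tau_n$, with $|\tau|=n$. The reduction of a sequence of $k$ distinct positive integers is the permutation in $\mathcal{S}_k$ obtained by replacing the smallest entry by $1$, the second smallest by $2$, and so on. For $1\le i\le j\le n$, $\tau_{[i,j]}\in\mathcal{S}_{j-i+1}$ is the reduction of $\tau_i\dots\tau_j$. The consecutive pattern poset $\mathcal{P}$ is the set $\bigcup_{n\ge1}\mathcal{S}_n$ with $\sigma\le\tau$ iff $\sigma=\tau_{[i,j]}$ for some $i\le j$. $[\sigma,\tau]=\{\pi:\sigma\le\pi\le\tau\}$ and $(\sigma,\tau)=\{\pi:\sigma<\pi<\tau\}$. The order complex $\Delta(\sigma,\tau)$ is the simplicial complex whose faces are the chains of $(\sigma,\tau)$; it is pure (all facets have the same dimension). A shelling of a pure $d$-dimensional simplicial complex is a linear ordering $F_1,\dots,F_s$ of its facets such that, regarding each facet as the subcomplex of all its faces, $\left(\bigcup_{j=1}^{k-1}F_j\right)\cap F_k$ is pure and $(d-1)$-dimensional for all $k=2,\dots,s$. A complex is shellable if it has a shelling, and $[\sigma,\tau]$ is shellable if $\Delta(\sigma,\tau)$ is. *)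

(* Defs.v *)
From HB Require Import structures.
From mathcomp Require Import all_boot all_order all_algebra all_fingroup.
From mathcomp Require Import finmap.
From mathcomp Require Import all_classical all_reals all_analysis.

Set Implicit Arguments.
Unset Strict Implicit.
Unset Printing Implicit Defensive.

Import Order.TTheory GRing.Theory Num.Theory.
Import numFieldNormedType.Exports.

Local Open Scope nat_scope.

Definition reduction (w : seq nat) : seq nat :=
  [seq count (fun y => y <= x) w | x <- w].

(* The disjoint union of the S_m over m >= 1, with m = n.+1. *)
Definition cpattern : Type := {n : nat & 'S_n.+1}.

HB.instance Definition _ := Choice.on cpattern.

Definition psize (p : cpattern) : nat := (tag p).+1.

(* The library's permutations act on {0, .., n}; words have entries in
   {1, .., n.+1}. *)
Definition oneline (p : cpattern) : seq nat :=
  [seq (tagged p i : nat).+1 | i <- enum 'I_(tag p).+1].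

(* The word of tau_[i+1, j+1]: positions are counted from 0. *)
Definition segment (i j : nat) (p : cpattern) : seq nat :=
  reduction (drop i (take j.+1 (oneline p))).

Definition cpattern_le (s t : cpattern) : bool :=
  [exists i : 'I_(psize t), exists j : 'I_(psize t),
    (i <= j) && (oneline s == segment i j t)].

Lemma size_oneline p : size (oneline p) = psize p.
Proof. by rewrite size_map size_enum_ord. Qed.

Lemma oneline_inj : injective oneline.
Proof.
move=> p q e.
have : psize p = psize q by rewrite -!size_oneline e.
case: p q e => [n u] [m v] e [nm]; rewrite /= in nm; subst m.
congr existT; apply/permP => i; apply/val_inj/succn_inj => /=.
move/eq_in_map: e => /(_ i); apply.
by rewrite mem_enum.
Qed.

Lemma reduction_map (f : nat -> nat) w :
  {in w &, {mono f : x y / x <= y}} -> reduction (map f w) = reduction w.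
Proof.
move=> fw; rewrite /reduction -map_comp; apply/eq_in_map => x xw /=.
by rewrite count_map; apply: eq_in_count => y yw /=; rewrite fw.
Qed.

Lemma reduction_mono w :
  {in w &, {mono (fun x => count (fun y => y <= x) w) : x y / x <= y}}.
Proof.
move=> x y xw yw /=; case: (leqP x y) => xy.
  by apply: sub_count => z /= zx; apply: leq_trans xy.
apply/negbTE; rewrite -ltnNge.
have -> : count (fun z => z <= y) w =
    count (fun z => z <= y) [seq z <- w | z <= x].
  rewrite count_filter; apply: eq_count => z /=.
  by case: (leqP z y) => //= zy; rewrite (leq_trans zy (ltnW xy)).
rewrite -(size_filter (fun z => z <= x)).
rewrite -[X in _ < X](count_predC (fun z => z <= y)).
rewrite -addn1 leq_add2l -has_count; apply/hasP; exists x => /=.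
  by rewrite mem_filter leqnn.
by rewrite -ltnNge.
Qed.

Lemma oneline_perm p : perm_eq (oneline p) (iota 1 (psize p)).
Proof.
rewrite (iotaDl 1 0) -val_enum_ord -map_comp /oneline.
rewrite (map_comp (fun k : 'I_(psize p) => (k : nat).+1) (tagged p)).
rewrite -/(psize p); apply: (@perm_map _ _ (fun k : 'I_(psize p) => k.+1)).
apply: uniq_perm; rewrite ?enum_uniq ?(map_inj_uniq perm_inj) ?enum_uniq//.
move=> k; rewrite mem_enum inE; apply/mapP.
by exists ((tagged p)^-1%g k); rewrite ?mem_enum// permKV.
Qed.

Lemma reduction_oneline p : reduction (oneline p) = oneline p.
Proof.
rewrite -[RHS]map_id; apply/eq_in_map => x.
rewrite (perm_mem (oneline_perm p)) mem_iota add1n ltnS => /andP[x0 xp].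
rewrite (seq.permP (oneline_perm p)) -[in iota _ _](subnKC xp) iotaD count_cat.
rewrite (_ : count _ (iota 1 x) = size (iota 1 x)); last first.
  apply/eqP; rewrite -all_count; apply/allP => y.
  by rewrite mem_iota add1n ltnS => /andP[].
rewrite size_iota (_ : count _ _ = 0) ?addn0//; apply/eqP.
rewrite -leqn0 leqNgt -has_count; apply/hasPn => y.
by rewrite mem_iota => /andP[xy _]; rewrite -ltnNge.
Qed.

Lemma cpattern_leP s t :
  reflect (exists i j, [/\ i <= j, j < psize t & oneline s = segment i j t])
          (cpattern_le s t).
Proof.
apply: (iffP existsP) => [[i /existsP[j /andP[ij /eqP e]]]|[i [j [ij jt e]]]].
  by exists i, j; split.
exists (Ordinal (leq_ltn_trans ij jt)); apply/existsP; exists (Ordinal jt).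
by rewrite /= ij e eqxx.
Qed.

Lemma size_segment i j p : i <= j -> j < psize p ->
  size (segment i j p) = j.+1 - i.
Proof.
by move=> ij jp; rewrite size_map size_drop size_takel // size_oneline.
Qed.

Lemma cpattern_le_refl : reflexive cpattern_le.
Proof.
move=> p; apply/cpattern_leP; exists 0, (psize p).-1; split => //.
by rewrite /segment drop0 take_oversize ?reduction_oneline// size_oneline.
Qed.

Lemma cpattern_le_anti : antisymmetric cpattern_le.
Proof.
move=> s t /andP[/cpattern_leP[i [j [ij jt e]]] /cpattern_leP[k [l [kl ls f]]]].
have := congr1 size e; have := congr1 size f.
rewrite !size_oneline !size_segment // => et es.
have tsz : psize t <= psize s by rewrite et (leq_trans (leq_subr _ _)).
have i0 : i = 0.
  apply/eqP; rewrite -leqn0 leqNgt; apply/negP => i_gt0.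
  by move: tsz; rewrite es leqNgt (leq_trans _ jt)// ltn_subrL i_gt0.
apply: oneline_inj; rewrite e /segment i0 drop0 take_oversize.
  exact: reduction_oneline.
by rewrite size_oneline (leq_trans tsz)// es i0 subn0.
Qed.

Lemma cpattern_le_trans : transitive cpattern_le.
Proof.
move=> t s u /cpattern_leP[i [j [ij jt e]]] /cpattern_leP[k [l [kl lu f]]].
have := congr1 size f; rewrite size_oneline size_segment // => st.
have jkl : j + k <= l.
  by rewrite st in jt; rewrite -ltnS addnC -ltn_subRL.
apply/cpattern_leP; exists (i + k), (j + k).
split; rewrite ?leq_add2r ?(leq_ltn_trans jkl)//.
rewrite e /segment f /segment.
set w := drop k _.
rewrite /reduction -map_take -map_drop -/(reduction _) reduction_map.
  rewrite -/(reduction _) /w take_drop take_takel ?drop_drop ?addSn//.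
by move=> x y /mem_drop/mem_take xw /mem_drop/mem_take yw; apply: reduction_mono.
Qed.

Fact cpattern_display : Order.disp_t. Proof. exact: Order.Disp tt tt. Qed.

HB.instance Definition _ := Order.Le_isPOrder.Build cpattern_display cpattern
  cpattern_le_refl cpattern_le_anti cpattern_le_trans.

Local Open Scope classical_set_scope.

(* A simplicial complex on vertices in T is given by its set of faces; it
   includes the empty face, of dimension -1. *)
Section Shellability.
Context {T : choiceType}.
Implicit Types (F G : {fset T}) (K : set {fset T}).

Definition simplicial_complex K : Prop :=
  K fset0 /\ forall F G, K F -> (G `<=` F)%fset -> K G.

Definition face_dim F : int := ((#|` F|)%:Z - 1)%R.

Definition facet K F : Prop := K F /\ forall G, K G -> (F `<=` G)%fset -> G = F.

Definition simplex F : set {fset T} := [set G | (G `<=` F)%fset].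

Definition pure_of_dim (d : int) K : Prop :=
  (exists F, facet K F) /\ forall F, facet K F -> face_dim F = d.

Definition shelling (d : int) K (s : seq {fset T}) : Prop :=
  [/\ uniq s,
      forall F, F \in s <-> facet K F &
      forall k, 0 < k < size s ->
        pure_of_dim (d - 1)%R
          ((\bigcup_(j in [set j | j < k]) simplex (nth fset0 s j))
            `&` simplex (nth fset0 s k))].

Definition shellable K : Prop :=
  exists d, pure_of_dim d K /\ exists s, shelling d K s.

End Shellability.

Section OrderComplex.
Context {disp : Order.disp_t} {T : porderType disp}.
Implicit Types (a b : T).

Definition chain (F : {fset T}) : Prop := {in F &, forall x y, (x >=< y)%O}.

Definition order_complex a b : set {fset T} :=
  [set F | chain F /\ {in F, forall x, (a < x < b)%O}].

Lemma order_complexP a b : simplicial_complex (order_complex a b).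
Proof.
split; first by split=> x; rewrite in_fset0.
move=> F G [cF abF] /fsubsetP GF.
by split=> [x y /GF xF /GF yF|x /GF xF]; [apply: cF|apply: abF].
Qed.

Definition shellable_interval a b : Prop := shellable (order_complex a b).

End OrderComplex.

Definition unif_finprob (R : realType) (T : finType) (E : set T) : R :=
  (#|[pred t | t \in E]|%:R / #|T|%:R)%R.

(* Main.v *)
Require Import Defs.
From mathcomp Require Import all_boot all_order all_algebra all_fingroup.
From mathcomp Require Import finmap.
From mathcomp Require Import all_classical all_reals all_analysis.
From mathcomp Require Import zify.
Import Order.TTheory GRing.Theory Num.Theory.
Import numFieldNormedType.Exports.

(** Fix sigma. The proof exhibits a single permutation r, depending only on
    sigma, such that [[sigma, tau]] is not shellable as soon as tau contains r;
    since a uniform random permutation contains any fixed pattern with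
    probability tending to 1, this is enough.

    The obstruction is disconnectedness. Suppose that s occurs in r exactly
    twice, as a prefix and as a suffix, without overlap, and that s has at least
    3 letters. A permutation strictly between s and r is then either a prefix
    of r or a suffix of r; it inherits exactly one of the two occurrences of s,
    and comparable permutations inherit the same one. So the open interval
    (s, r) splits into two classes with no comparability between them, and each
    class contains a chain of 2 elements ([straddled_not_shellable]).

    A shellable pure complex cannot hide such an interval: let C be a face whose
    link is the order complex of (s, r). The facets through C fall into
    two classes, according to the side that they visit. At the first facet F_k
    through C whose class differs from that of the first facet through C, purity
    of the intersection with the union of the earlier facets yields
    a face G of F_k, of codimension 1 and containing C, that lies in an earlier
    facet. This G retains an element of (s, r), on which the classes of the two
    facets must agree, a contradiction ([disconnected_not_shellable]).

    To construct r for a given sigma of size k, let s be an increasing run of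
    k+1 large letters followed by sigma, and let r be two copies of s, the
    first one above the second. An occurrence of s in r must start with k
    consecutive ascents, and the descents of r leave room for this only at the
    beginning of the copies ([exists_straddled]).

    Finally, cut the positions of tau into disjoint blocks of length K = |r|.
    Rearranging the letters inside one block by one of K! permutations makes r
    occur there, without changing the other blocks; so among the tau that
    do not show r in any of the first q blocks, at most the fraction 1 - 1/K!
    does not show it in the next block either ([card_avoiders_step]). In S_n the
    probability of avoiding r is thus at most (1 - 1/K!) ^ (n / K), with the
    exponent rounded down, and this tends to 0. *)

(** * Disconnected intervals obstruct shellability *)

Lemma face_sub_facet {T : choiceType} (K : set {fset T}) (N : nat) F0 :
  (forall F, K F -> #|` F| <= N) -> K F0 ->
  exists2 F, facet K F & (F0 `<=` F)%fset.
Proof.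
move=> KN; have [m] := ubnP (N - #|` F0|); elim: m F0 => // m IH F0 mF KF0.
have [ext|noext] := pselect (exists2 G, K G & (F0 `<` G)%fset).
  case: ext => G KG FG; have ltFG := fproper_ltn_card FG.
  have leG := KN _ KG.
  have [|F fF GF] := IH G _ KG; first by lia.
  by exists F => //; apply: fsubset_trans GF; apply: fproper_sub.
exists F0 => //; split=> // G KG FG; apply/eqP.
rewrite eq_sym eqEfsubset FG /=; apply: contrapT => nGF; apply: noext.
by exists G => //; rewrite fproperE FG; apply/negP.
Qed.

Lemma chain_card_le {disp} {T : porderType disp} (rk : T -> nat) a b F :
  {homo rk : x y / (x < y)%O >-> (x < y)%N} ->
  order_complex a b F -> #|` F| <= rk b.
Proof.
move=> rkP [cF abF].
rewrite -(size_iota 0 (rk b)) -(size_map rk (enum_fset F)).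
apply: uniq_leq_size => [|_ /mapP[x xF ->]]; last first.
  by rewrite mem_iota /= add0n; apply: rkP; case/andP: (abF _ xF).
rewrite map_inj_in_uniq ?fset_uniq// => x y xF yF exy.
have := cF _ _ xF yF; case: comparableP => // /rkP; rewrite exy ltnn //.
Qed.

(** The class of an element of (s, r) is its value under [P], which is constant
    on comparable pairs, so the order complex of (s, r) is disconnected; [x1] and
    [x2] make it of positive dimension (two incomparable points are shellable).
    Comparing the classes of the facets through a suitable face [C] contradicts
    shellability. *)
Lemma disconnected_not_shellable {disp} {T : porderType disp} (rk : T -> nat)
    (a s r b x1 x2 y1 : T) (P : pred T) :
  {homo rk : x y / (x < y)%O >-> (x < y)%N} ->
  (a <= s)%O -> (r <= b)%O ->
  (s < x1)%O -> (x1 < x2)%O -> (x2 < r)%O -> (s < y1 < r)%O ->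
  (forall x y, (s < x)%O -> (x < y)%O -> (y < r)%O -> P x = P y) ->
  P x1 != P y1 -> ~ shellable_interval a b.
Proof.
move=> rkP leas lerb sx1 x12 x2r /andP[sy1 y1r] Pcst Pxy.
move=> [d [[_ dimK] [L [_ facetL shellL]]]].
set K := order_complex a b in dimK facetL shellL.
have sr : (s < r)%O := lt_trans sy1 y1r.
have midK x : (s < x < r)%O -> (a < x < b)%O.
  by case/andP=> sx xr; rewrite (le_lt_trans leas sx) (lt_le_trans xr lerb).
have extend F0 : K F0 -> exists2 F, facet K F & (F0 `<=` F)%fset.
  by apply: face_sub_facet => F; apply: chain_card_le rkP.
(* A facet through s, x1, x2 and r; s or r may be an end of the ambient
   interval, in which case it is not a vertex. *)
pose F0 := [fset x in [:: s; x1; x2; r] | (a < x < b)%O]%fset.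
have [F facF F0F] : exists2 F, facet K F & (F0 `<=` F)%fset.
  apply: extend; split=> [x y|x]; last by rewrite !inE => /andP[].
  rewrite !inE => /andP[xl _] /andP[yl _].
  have sx2 := lt_trans sx1 x12; have x1r := lt_trans x12 x2r.
  by case/or4P: xl => /eqP->; case/or4P: yl => /eqP->;
    first [exact: comparablexx | exact: lt_comparable | exact: gt_comparable].
have [[cF abF] maxF] := facF.
have inF x : x \in [:: s; x1; x2; r] -> (a < x < b)%O -> x \in F.
  by move=> xl xab; apply: (fsubsetP F0F); rewrite !inE /= in xl *; rewrite xl.
pose C := [fset x in F | (x <= s)%O || (r <= x)%O]%fset.
have CE x : (x \in C) = (x \in F) && ((x <= s)%O || (r <= x)%O).
  by rewrite !inE.
have CF : (C `<=` F)%fset by apply/fsubsetP => x; rewrite CE => /andP[].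
have mid_or_out G x : K G -> (C `<=` G)%fset -> x \in G ->
    ~~ ((x <= s)%O || (r <= x)%O) -> (s < x < r)%O.
  move=> [cG abG] /fsubsetP CG xG; have /andP[ax xb] := abG _ xG.
  have cmps : (x >=< s)%O.
    move: leas; rewrite le_eqVlt => /orP[/eqP<-|las]; first exact: gt_comparable.
    apply: cG => //; apply: CG; rewrite CE lexx andbT; apply: inF.
      by rewrite !inE eqxx.
    by rewrite las (lt_le_trans sr lerb).
  have cmpr : (x >=< r)%O.
    move: lerb; rewrite le_eqVlt => /orP[/eqP->|lrb]; first exact: lt_comparable.
    apply: cG => //; apply: CG; rewrite CE lexx orbT andbT; apply: inF.
      by rewrite !inE eqxx !orbT.
    by rewrite lrb (le_lt_trans leas sr).
  by rewrite (comparable_leNgt cmps) [(r <= x)%O]comparable_leNgt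
    1?comparable_sym// negb_or !negbK.
(* C is saturated below s and above r, so a facet through C adds to it only
   elements strictly between s and r. *)
have mid G x : K G -> (C `<=` G)%fset -> x \in G -> x \notin C ->
    (s < x < r)%O.
  move=> KG CG xG xC; apply: (mid_or_out G) => //.
  apply: contra xC => xout; rewrite CE xout andbT.
  suff KxF : K (x |` F)%fset.
    by rewrite -(maxF _ KxF) ?fsubsetUr// !inE eqxx.
  have cmpx y : y \in F -> (x >=< y)%O.
    move=> yF; have [yC|] := boolP (y \in C).
      by apply: KG.1 => //; apply: (fsubsetP CG).
    rewrite CE yF /= => /(mid_or_out F y facF.1 CF yF)/andP[sy yr].
    case/orP: xout => [xs|rx]; first exact/lt_comparable/(le_lt_trans xs).
    exact/gt_comparable/(lt_le_trans yr).
  split=> [y z|y].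
    rewrite !inE => /predU1P[->|yF] /predU1P[->|zF]; last exact: cF.
    - exact: comparablexx.
    - exact: cmpx.
    - by rewrite comparable_sym; apply: cmpx.
  by rewrite !inE => /predU1P[->|/abF//]; apply: KG.2.
(* The class of a facet through C: the component its new elements lie in. *)
pose typ G := has (fun x => (x \notin C) && P x) (enum_fset G).
have typP G x : K G -> (C `<=` G)%fset -> x \in G -> x \notin C -> typ G = P x.
  move=> KG CG xG xC; apply/hasP/idP => [[y yG /andP[yC Py]]|Px]; last first.
    by exists x => //; rewrite xC.
  have /andP[sx xr] := mid _ _ KG CG xG xC.
  have /andP[sy yr] := mid _ _ KG CG yG yC.
  have := KG.1 _ _ xG yG; case: (comparableP x y) => // [xy|yx|->] _ //.
    by rewrite (Pcst x y).
  by rewrite -(Pcst y x).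
have notC x : (s < x < r)%O -> x \notin C.
  move=> /andP[sx xr]; rewrite CE negb_and negb_or.
  by rewrite (lt_geF sx) (lt_geF xr) orbT.
have x1F : x1 \in F.
  by apply: inF; rewrite ?inE ?eqxx ?orbT// midK// sx1 (lt_trans x12 x2r).
have x2F : x2 \in F.
  by apply: inF; rewrite ?inE ?eqxx ?orbT// midK// x2r (lt_trans sx1 x12).
have x1C : x1 \notin C by rewrite notC// sx1 (lt_trans x12 x2r).
have x2C : x2 \notin C by rewrite notC// x2r (lt_trans sx1 x12).
have cardF G : facet K G -> (#|` C|.+2 <= #|` G|)%N.
  move=> facG.
  have /addIr[->] : face_dim G = face_dim F by rewrite (dimK G)// (dimK F).
  have -> : #|` C|.+2 = #|` (x1 |` (x2 |` C))%fset|.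
    rewrite !cardfsU1 x2C !inE negb_or (lt_eqF x12) /=.
    by move: x1C; rewrite !inE => ->.
  by apply: fsubset_leq_card; rewrite !fsubUset CF !fsub1set x1F x2F.
have [G facG yCG] : exists2 G, facet K G & ((y1 |` C) `<=` G)%fset.
  apply: extend; have KC : K C.
    by case: (order_complexP a b) => _; apply; first exact: facF.1.
  have cmpy z : z \in C -> (y1 >=< z)%O.
    rewrite CE => /andP[_ /orP[zs|rz]]; first exact/gt_comparable/(le_lt_trans zs).
    exact/lt_comparable/(lt_le_trans y1r).
  split=> [y z|y].
    rewrite !in_fset1U => /predU1P[->|yC] /predU1P[->|zC].
    - exact: comparablexx.
    - exact: cmpy.
    - by rewrite comparable_sym; apply: cmpy.
    - exact: KC.1.
  rewrite in_fset1U => /predU1P[->|/KC.2//].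
  by apply: midK; rewrite sy1.
move: yCG; rewrite fsubUset fsub1set => /andP[y1G CG].
have typF : typ F = P x1 by apply: typP => //; exact: facF.1.
have typG : typ G = P y1 by apply: typP => //; [exact: facG.1|rewrite notC ?sy1].
have {Pxy} FGtyp : typ F != typ G by rewrite typF typG.
(* i0 is the first facet through C, and k the first one through C in the
   other class. *)
pose i0 := find (fun H : {fset T} => C `<=` H)%fset L.
have hasC : has (fun H : {fset T} => C `<=` H)%fset L.
  by apply/hasP; exists F => //; apply/facetL.
pose q (H : {fset T}) := (C `<=` H)%fset && (typ H != typ (nth fset0 L i0)).
have hasq : has q L.
  have [e|ne] := eqVneq (typ F) (typ (nth fset0 L i0)); apply/hasP.
    by exists G; [apply/facetL|rewrite /q CG -e eq_sym].
  by exists F; [apply/facetL|rewrite /q CF].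
pose k := find q L.
have ltkL : k < size L by rewrite -has_find.
have /andP[CFk typk] : q (nth fset0 L k) := nth_find fset0 hasq.
have i0k : i0 < k.
  rewrite ltn_neqAle; apply/andP; split.
    by apply: contraNneq typk => <-.
  rewrite leqNgt; apply/negP => /(before_find fset0).
  by rewrite CFk.
have facL i : i < size L -> facet K (nth fset0 L i).
  by move=> iL; apply/facetL/mem_nth.
have facFk := facL _ ltkL.
have k0 : 0 < k by apply: leq_ltn_trans i0k.
have [_ pureI] := shellL k (introT andP (conj k0 ltkL)).
set I := (X in facet X) in pureI.
have IC : I C.
  split; last exact: CFk.
  by exists i0 => //; apply: (nth_find fset0 hasC).
have [H facH CH] := @face_sub_facet _ I #|` nth fset0 L k| C
  (fun H HI => fsubset_leq_card HI.2) IC.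
have [[i /= ik HFi] HFk] := facH.1.
have [x xH xC] : exists2 x, x \in H & x \notin C.
  apply/fsubsetPn; apply/negP => /fsubset_leq_card.
  have := pureI _ facH; have := cardF _ facFk.
  rewrite -(dimK _ facFk) /face_dim; move: (#|` H|) (#|` C|) (#|` _|).
  by move=> h c f; clear; lia.
have facFi := facL _ (ltn_trans ik ltkL).
have CFi : (C `<=` nth fset0 L i)%fset by apply: fsubset_trans HFi.
have := before_find fset0 ik; rewrite /q CFi /= => /negbFE/eqP typi.
case/eqP: typk; rewrite -typi.
rewrite (typP _ x facFk.1 CFk (fsubsetP HFk _ xH) xC).
by rewrite (typP _ x facFi.1 CFi (fsubsetP HFi _ xH) xC).
Qed.

(** * Occurrences of consecutive patterns *)

Definition as_pattern {n} (tau : 'S_n.+1) : cpattern :=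
  existT (fun m => 'S_m.+1) n tau.

Definition letter (p : cpattern) (a : nat) : nat := nth 0 (oneline p) a.

Definition occurs_at (s t : cpattern) (i : nat) : bool :=
  (i + psize s <= psize t) &&
  (oneline s == reduction (take (psize s) (drop i (oneline t)))).

(** Since order isomorphism passes to subwords and composes, this turns the
    manipulation of windows and of their reductions into index arithmetic. *)
Lemma reduction_eqP (u v : seq nat) : size u = size v ->
  reduction u = reduction v <->
  forall a b, a < size u -> b < size u ->
    (nth 0 u a <= nth 0 u b) = (nth 0 v a <= nth 0 v b).
Proof.
move=> uv; split=> [e a b au bu|e].
  have nthr w c : c < size w -> nth 0 (reduction w) c =
      count (fun y => y <= nth 0 w c) w by move=> cw; rewrite (nth_map 0).
  have mono w : a < size w -> b < size w ->
      (nth 0 w a <= nth 0 w b) =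
      (nth 0 (reduction w) a <= nth 0 (reduction w) b).
    by move=> aw bw; rewrite !nthr// (@reduction_mono w) ?mem_nth.
  by rewrite mono// e -mono// -uv.
apply: (@eq_from_nth _ 0) => [|a]; rewrite !size_map// => au.
have av : a < size v by rewrite -uv.
rewrite !(nth_map 0)//.
have cnt w c : count (fun y => y <= c) w =
    count (fun b => nth 0 w b <= c) (iota 0 (size w)).
  by rewrite -{1}(mkseq_nth 0 w) /mkseq count_map.
rewrite !cnt -uv; apply: eq_in_count => b.
by rewrite mem_iota /= add0n => bu; apply: e.
Qed.

Lemma occurs_atP (s t : cpattern) i :
  reflect (i + psize s <= psize t /\
    forall a b, a < psize s -> b < psize s ->
      (letter s a <= letter s b) = (letter t (i + a) <= letter t (i + b)))
    (occurs_at s t i).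
Proof.
rewrite /occurs_at; case: leqP => /= [ist|_]; last by constructor; case.
set w := take _ _.
have szw : size w = psize s.
  rewrite size_takel// size_drop size_oneline.
  by rewrite leq_subRL ?(leq_trans _ ist)// leq_addr.
have nthw c : c < psize s -> nth 0 w c = letter t (i + c).
  by move=> cs; rewrite nth_take// nth_drop.
have H := reduction_eqP (oneline s) w; rewrite size_oneline in H.
rewrite -{1}(reduction_oneline s).
apply: (iffP eqP) => [/(H (esym szw)) e|[_ e]].
  by split=> // a b sa sb; rewrite -!nthw// -e.
by apply/(H (esym szw)) => a b sa sb; rewrite !nthw// -e.
Qed.

Lemma cpattern_le_occurs (s t : cpattern) :
  reflect (exists i, occurs_at s t i) (s <= t)%O.
Proof.
apply: (iffP (cpattern_leP s t)) => [[i [j [ij jt e]]]|[i /andP[ist /eqP e]]].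
  have := congr1 size e; rewrite size_oneline size_segment// => sz.
  have ij1 : i <= j.+1 by apply: leqW.
  exists i; rewrite /occurs_at sz take_drop subnK//.
  by rewrite subnKC// jt e eqxx.
exists i, (i + psize s).-1.
have s0 : 0 < psize s by [].
have e1 : (i + psize s).-1.+1 = i + psize s by lia.
by split; [lia|lia|rewrite e /segment e1 take_drop addnC].
Qed.

Lemma occurs_at_trans s t u i j :
  occurs_at s t i -> occurs_at t u j -> occurs_at s u (j + i).
Proof.
move=> /occurs_atP[ist est] /occurs_atP[jtu etu]; apply/occurs_atP; split.
  by lia.
by move=> a b sa sb; rewrite est// etu ?addnA//; lia.
Qed.

Lemma occurs_at_within s x t i j :
  occurs_at s t (j + i) -> occurs_at x t j -> i + psize s <= psize x ->
  occurs_at s x i.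
Proof.
move=> /occurs_atP[_ est] /occurs_atP[_ ext] isx; apply/occurs_atP.
by split=> // a b sa sb; rewrite est// ext ?addnA//; lia.
Qed.

Lemma occurs_at_size_eq s t i : psize t <= psize s -> occurs_at s t i -> s = t.
Proof.
move=> ts /andP[ist /eqP e]; apply: oneline_inj.
have i0 : i = 0 by lia.
by rewrite e i0 drop0 take_oversize ?size_oneline// reduction_oneline.
Qed.

Lemma psize_lt : {homo psize : s t / (s < t)%O >-> s < t}.
Proof.
move=> s t; rewrite lt_neqAle => /andP[st /cpattern_le_occurs[i occ]].
rewrite ltnNge; apply: contra st => ts; apply/eqP.
exact: occurs_at_size_eq occ.
Qed.

Lemma occurs_at_lt s t i : occurs_at s t i -> psize s < psize t -> (s < t)%O.
Proof.
move=> occ st; rewrite lt_neqAle; apply/andP; split.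
  by apply: contraTneq st => ->; rewrite ltnn.
by apply/cpattern_le_occurs; exists i.
Qed.

(** Permutations can be specified up to order isomorphism by any injective
    word of numbers, which avoids computing their letters. *)
Lemma exists_pattern (f : nat -> nat) n :
  {in gtn n.+1 &, injective f} ->
  exists2 p, psize p = n.+1 &
    forall a b, a < n.+1 -> b < n.+1 ->
      (letter p a <= letter p b) = (f a <= f b).
Proof.
move=> finj; pose w := mkseq f n.+1.
pose c x := count (fun y => y <= x) w.
have cmono x y : x \in w -> y \in w -> (c x <= c y) = (x <= y).
  by move=> xw yw; rewrite /c (@reduction_mono w).
have fw (a : 'I_n.+1) : f a \in w by apply: map_f; rewrite mem_iota /=.
have cpos (a : 'I_n.+1) : 0 < c (f a).
  by rewrite -has_count; apply/hasP; exists (f a).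
have clt (a : 'I_n.+1) : (c (f a)).-1 < n.+1.
  have := count_size (fun y => y <= f a) w; rewrite size_mkseq -/(c (f a)).
  by rewrite prednK.
have ginj : injective (fun a : 'I_n.+1 => Ordinal (clt a)).
  move=> a b [] e; apply/val_inj/finj; rewrite ?inE ?ltn_ord//.
  have {}e : c (f a) = c (f b) by rewrite -(prednK (cpos a)) e prednK.
  by apply/eqP; rewrite eqn_leq -(cmono (f a) (f b))// -(cmono (f b) (f a))// e leqnn.
exists (as_pattern (perm ginj)) => // a b an bn.
have lE x (xn : x < n.+1) : letter (as_pattern (perm ginj)) x = c (f x).
  rewrite /letter (nth_map ord0) ?size_enum_ord//= permE /=.
  by rewrite nth_enum_ord// (prednK (cpos (Ordinal xn))).
by rewrite !lE// cmono// (fw (Ordinal an), fw (Ordinal bn)).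
Qed.

Lemma letter_bounds p a : a < psize p -> 0 < letter p a <= psize p.
Proof.
move=> ap; have : letter p a \in iota 1 (psize p).
  by rewrite -(perm_mem (oneline_perm p)) mem_nth// size_oneline.
by rewrite mem_iota add1n ltnS.
Qed.

Lemma letter_le p a : a < psize p -> letter p a <= psize p.
Proof. by move=> ap; have /andP[] := letter_bounds p a ap. Qed.

Lemma letter_gt0 p a : a < psize p -> 0 < letter p a.
Proof. by move=> ap; have /andP[] := letter_bounds p a ap. Qed.

Lemma letter_inj p : {in gtn (psize p) &, injective (letter p)}.
Proof.
move=> a b; rewrite !inE => ap bp /eqP.
rewrite nth_uniq ?size_oneline//; first by move/eqP.
by rewrite (perm_uniq (oneline_perm p)) iota_uniq.
Qed.

Lemma sub_pattern (t : cpattern) i n : i + n < psize t ->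
  exists2 s, psize s = n.+1 & occurs_at s t i.
Proof.
move=> int.
have [|p pn pE] := exists_pattern (fun a => letter t (i + a)) n.
  move=> a b; rewrite !inE => an bn /(@letter_inj t) e.
  by apply/eqP; rewrite -(eqn_add2l i) e ?inE//; lia.
by exists p => //; apply/occurs_atP; rewrite pn addnS.
Qed.

(** * Patterns with exactly two occurrences *)

(** For k = |sigma|, s consists of the letters k+1, .., 2k+1 in increasing order
    followed by sigma, and r of s shifted up by |s| followed by s. The run is
    longer than sigma, so an occurrence of s in r at another place would put
    a descent of r, at the end of a run or of a copy of s, under its own run. *)
Lemma exists_straddled (sigma : cpattern) :
  exists s r : cpattern, [/\ (sigma <= s)%O, 3 <= psize s,
    psize r = psize s + psize s, occurs_at s r 0 /\ occurs_at s r (psize s) &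
    forall q, occurs_at s r q -> q = 0 \/ q = psize s].
Proof.
have [k kE] : exists k, k = psize sigma by exists (psize sigma).
have k0 : 0 < k by rewrite kE.
have sigma_le a : a < k -> letter sigma a <= k by rewrite kE; apply: letter_le.
pose f a := if a <= k then k.+1 + a else letter sigma (a - k.+1).
have f_run a : a <= k -> f a = k.+1 + a by rewrite /f => ->.
have f_sigma a : f (k.+1 + a) = letter sigma a.
  by rewrite /f leqNgt leq_addr addKn.
have [|s sL sE] := exists_pattern f (k + k).
  move=> a b; rewrite !inE /f => ak bk; case: leqP => ka; case: leqP => kb.
  - by lia.
  - by have := sigma_le (b - k.+1); lia.
  - by have := sigma_le (a - k.+1); lia.
  - by move/(@letter_inj sigma); rewrite !inE -kE; lia.
pose g a := if a < psize s then psize s + letter s a else letter s (a - psize s).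
have g_fst a : a < psize s -> g a = psize s + letter s a by rewrite /g => ->.
have g_snd a : g (psize s + a) = letter s a.
  by rewrite /g ltnNge leq_addr addKn.
have s_le a : a < psize s -> letter s a <= psize s by apply: letter_le.
have s_gt0 a : a < psize s -> 0 < letter s a by apply: letter_gt0.
have [|r rL rE] := exists_pattern g (psize s + (k + k)).
  move=> a b; rewrite !inE /g => ak bk; case: ltnP => ka; case: ltnP => kb.
  - by move/addnI/(@letter_inj s) => ->; rewrite ?inE.
  - by have := s_gt0 a; have := s_le (b - psize s); lia.
  - by have := s_gt0 b; have := s_le (a - psize s); lia.
  - by move/(@letter_inj s); rewrite !inE; lia.
rewrite -addnS -sL in rL rE; rewrite sL in rL rE s_le s_gt0 g_fst g_snd.
clearbody f g.
exists s, r; rewrite sL; split => //.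
- apply/cpattern_le_occurs; exists k.+1; apply/occurs_atP; rewrite -kE sL.
  split=> [|a b ak bk]; first by lia.
  by rewrite sE ?f_sigma //; lia.
- by lia.
- split; apply/occurs_atP; rewrite rL sL; split=> [|a b ak bk]; [lia| |lia|].
    by rewrite !add0n rE ?g_fst ?leq_add2l//; lia.
  by rewrite rE ?g_snd//; lia.
move=> q /occurs_atP[qsr occ]; rewrite rL sL in qsr occ.
(* s begins with k ascents, so r has none of its descents at q, .., q+k-1. *)
have asc a : a < k -> letter r (q + a) <= letter r (q + a.+1).
  by move=> ak; rewrite -occ ?sE ?f_run; lia.
have no_desc d : q <= d -> d < q + k -> g d <= g d.+1.
  move=> qd dq; have := asc (d - q); rewrite addnS subnKC// rE; [|lia|lia].
  by apply; lia.
have sdesc a b : f a < f b -> a < (k + k).+1 -> b < (k + k).+1 ->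
    letter s a < letter s b.
  by move=> ab ak bk; rewrite ltnNge sE// -ltnNge.
have [->|q0] := posnP q; first by left.
have [->|qs] := eqVneq q (k + k).+1; first by right.
have {}qs : q < (k + k).+1 by lia.
have [qk|kq] := leqP q k.
  (* q lies in the first run of r, whose final descent, at k, is then at most
     k-1 places after q. *)
  have d1 : letter s k.+1 < letter s k.
    apply: sdesc; [|lia|lia]; rewrite -[k.+1]addn0 f_sigma f_run//.
    by have := sigma_le 0 k0; lia.
  have := no_desc k qk; rewrite !g_fst; [|lia|lia].
  by move: d1; move: (letter s _) (letter s _) => u v uv; lia.
(* q lies in the first copy of sigma; since sigma has only k letters, the
   descent at k+k, from one copy of s to the next, is at most k-1 places after
   q. *)
have := no_desc (k + k); rewrite g_fst; last by lia.
have := g_snd 0; rewrite addn0 => ->.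
have := s_le 0 isT; have := s_gt0 (k + k) (ltnSn _).
move: (letter s _) (letter s _) => u v; lia.
Qed.

(** The two classes of (s, r) are the permutations that begin with s and those
    that do not; the former are the prefixes of r and the latter its suffixes. *)
Lemma straddled_not_shellable (sigma s r tau : cpattern) :
  3 <= psize s -> psize r = psize s + psize s ->
  occurs_at s r 0 -> occurs_at s r (psize s) ->
  (forall q, occurs_at s r q -> q = 0 \/ q = psize s) ->
  (sigma <= s)%O -> (r <= tau)%O -> ~ shellable_interval sigma tau.
Proof.
move=> s3 rL occ0 occL occs leas lerb.
(* x lies strictly between s and r, so it cannot miss both occurrences of s
   in r, and it is too short to contain both. *)
have prefixE x j : (s < x)%O -> (x < r)%O -> occurs_at x r j ->
    occurs_at s x 0 = (j == 0).
  move=> sx xr occx; have := psize_lt _ _ sx; have := psize_lt _ _ xr.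
  move/ltW/cpattern_le_occurs: sx => [p occp] ltxr ltsx.
  apply/idP/eqP => [sx0|j0].
    have := occs _ (occurs_at_trans _ _ _ _ _ sx0 occx).
    by move/occurs_atP: occx => [jx _]; lia.
  have := occs _ (occurs_at_trans _ _ _ _ _ occp occx).
  have /occurs_atP[px _] := occp.
  by rewrite j0 => -[p0|pL]; [rewrite -p0 | lia].
(* x1 and x2 are the prefixes of r with one and two letters more than s, and
   y1 is the suffix with one letter more; 3 <= psize s leaves room for x2. *)
have [|x2 x2sz x2r] := @sub_pattern r 0 (psize s).+1; first by lia.
have [|x1 x1sz x12] := @sub_pattern x2 0 (psize s); first by lia.
have [|y1 y1sz y1r] := @sub_pattern r (psize s).-1 (psize s); first by lia.
have x1r : occurs_at x1 r 0 := occurs_at_trans _ _ _ _ _ x12 x2r.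
have sx1 : (s < x1)%O.
  apply: (@occurs_at_lt _ _ 0); last by lia.
  by apply: (occurs_at_within _ _ _ 0 0 occ0 x1r); lia.
have sy1 : (s < y1)%O.
  apply: (@occurs_at_lt _ _ 1); last by lia.
  apply: (occurs_at_within _ _ r 1 (psize s).-1) => //; last by lia.
  by rewrite addn1 prednK.
have {}x12 : (x1 < x2)%O by apply: occurs_at_lt x12 _; lia.
have ltx2r : (x2 < r)%O by apply: occurs_at_lt x2r _; lia.
have lty1r : (y1 < r)%O by apply: occurs_at_lt y1r _; lia.
apply: (disconnected_not_shellable psize sigma s r tau x1 x2 y1
          (fun x => occurs_at s x 0) psize_lt leas lerb sx1 x12 ltx2r).
- by rewrite sy1.
- move=> x y sx xy yr; have sy := lt_trans sx xy; have xr := lt_trans xy yr.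
  have /ltW/cpattern_le_occurs[i occi] := xy.
  have /ltW/cpattern_le_occurs[j occj] := yr.
  have occx := occurs_at_trans _ _ _ _ _ occi occj.
  rewrite (prefixE x _ sx xr occx) (prefixE y _ sy yr occj) addn_eq0.
  case: eqP => //= j0; apply/eqP.
  have /ltW/cpattern_le_occurs[p occp] := sx.
  have := occs _ (occurs_at_trans _ _ _ _ _ occp occx).
  move/occurs_atP: occp => [px _]; move/occurs_atP: occi => [iy _].
  have := psize_lt _ _ yr; rewrite j0 rL; clear -px iy => *; lia.
- rewrite (prefixE x1 0) ?(lt_trans x12)// (prefixE y1 _ sy1 lty1r y1r) eqxx.
  by case: eqP => // L0; clear -s3 L0; lia.
Qed.

(** * Avoiding a pattern in disjoint blocks *)

Definition avoiders (rho : cpattern) n (q : nat) : {set 'S_n.+1} :=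
  [set tau | [forall b : 'I_q,
                ~~ occurs_at rho (as_pattern tau) (b * psize rho)]].

Lemma letter_as_pattern {n} (tau : 'S_n.+1) (a : 'I_n.+1) :
  letter (as_pattern tau) a = (tau a).+1.
Proof.
rewrite /letter (nth_map ord0) ?size_enum_ord//=.
by rewrite nth_ord_enum.
Qed.

(** If p is the pattern of tau in the block, the letters of rho are those of p
    read in the order p^-1 rho. *)
Lemma rearrange_block (rho : cpattern) n (tau : 'S_n.+1) i :
  i + psize rho <= n.+1 ->
  exists2 g : 'S_n.+1,
    perm_on [set x : 'I_n.+1 | i <= x < i + psize rho] g &
    occurs_at rho (as_pattern (g * tau)%g) i.
Proof.
move=> irn.
have [|[m p] /= psz /occurs_atP[_ pE]] :=
  @sub_pattern (as_pattern tau) i (psize rho).-1.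
  by rewrite /= -addnS.
case: rho irn psz => K r irn [mK]; subst m; rewrite /psize /= in irn pE *.
pose h : 'S_K.+1 := (r * p^-1)%g.
have inblock (a : 'I_K.+1) : i + a < n.+1.
  by apply: leq_trans irn; rewrite ltn_add2l.
pose e a := Ordinal (inblock a).
pose X := [set x : 'I_n.+1 | i <= x < i + K.+1].
have eX a : e a \in X by rewrite inE leq_addr ltn_add2l /=.
pose G (x : 'I_n.+1) := if x \in X then e (h (inord (x - i))) else x.
have Ge a : G (e a) = e (h a).
  by rewrite /G eX /= addKn inord_val.
have XE x : x \in X -> exists a, x = e a.
  rewrite inE => /andP[ix xi].
  by exists (inord (x - i)); apply/val_inj; rewrite /= inordK; lia.
have Ginj : injective G.
  move=> x y; have [/XE[a ->]|xX] := boolP (x \in X);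
    have [/XE[b ->]|yX] := boolP (y \in X).
  - rewrite !Ge => /(congr1 val)/= /addnI/val_inj/perm_inj -> //.
  - by rewrite Ge {1}/G (negPf yX) => yE; rewrite -yE eX in yX.
  - by rewrite Ge {1}/G (negPf xX) => xE; rewrite xE eX in xX.
  - by rewrite /G (negPf xX) (negPf yX).
exists (perm Ginj).
  apply/fintype.subsetP => x; rewrite unfold_in /= permE /G.
  by case: ifP => //; rewrite eqxx.
apply/occurs_atP; split => // a b aK bK; rewrite /psize /= in aK bK.
have lE c (cK : c < K.+1) : letter (as_pattern (perm Ginj * tau)%g) (i + c) =
    letter (as_pattern tau) (i + h (Ordinal cK)).
  have := letter_as_pattern (perm Ginj * tau)%g (e (Ordinal cK)).
  rewrite permM permE Ge /= => ->.
  by rewrite -(letter_as_pattern tau (e (h (Ordinal cK)))).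
have hE c (cK : c < K.+1) : letter (as_pattern p) (h (Ordinal cK)) =
    letter (as_pattern r) c.
  rewrite letter_as_pattern permM permKV.
  by rewrite -(letter_as_pattern r (Ordinal cK)).
by rewrite !lE -pE ?ltn_ord// !hE.
Qed.

Lemma perm_on_fix_occurs (rho : cpattern) n (g tau : 'S_n.+1) X i :
  perm_on X g -> (forall x : 'I_n.+1, i <= x < i + psize rho -> x \notin X) ->
  occurs_at rho (as_pattern (g * tau)%g) i = occurs_at rho (as_pattern tau) i.
Proof.
move=> gX iX.
have lE a : i + a < n.+1 -> a < psize rho ->
    letter (as_pattern (g * tau)%g) (i + a) = letter (as_pattern tau) (i + a).
  move=> an ar; rewrite -[i + a]/(nat_of_ord (Ordinal an)) !letter_as_pattern.
  by rewrite permM (out_perm gX)// iX//= leq_addr ltn_add2l.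
apply/occurs_atP/occurs_atP; rewrite /psize /= -/(psize rho) => -[irn e];
  split=> // a b ar br; rewrite e// !lE//; lia.
Qed.

(** The permutations that avoid rho in the first q blocks and have it in the
    next one are at least a fraction 1/K! of those that avoid it in the first q
    blocks, where K = |rho|: each of the latter becomes one of the former under
    one of the K! rearrangements of the next block. *)
Lemma card_avoiders_step (rho : cpattern) n q :
  q.+1 * psize rho <= n.+1 ->
  (psize rho)`! * #|avoiders rho n q.+1|
    <= (psize rho)`!.-1 * #|avoiders rho n q|.
Proof.
move=> qn; pose K := psize rho; pose A := avoiders rho n q; rewrite -/K -/A.
rewrite -/K in qn.
pose hit : pred 'S_n.+1 := fun tau => occurs_at rho (as_pattern tau) (q * K).
pose X := [set x : 'I_n.+1 | q * K <= x < q * K + K].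
have cardX : #|X| <= K.
  rewrite -(size_iota (q * K) K) cardE -(size_map val).
  apply: uniq_leq_size => [|_ /mapP[x + ->]].
    by rewrite map_inj_uniq ?enum_uniq//; exact: val_inj.
  by rewrite mem_enum inE mem_iota.
have avS : avoiders rho n q.+1 = [set tau in A | ~~ hit tau].
  apply/setP => tau; rewrite !inE; apply/forallP/andP => [av|[/forallP av nh] b].
    split; last exact: (av ord_max).
    by apply/forallP => b; apply: (av (widen_ord (leqnSn q) b)).
  have [bq|] := ltnP b q; first exact: (av (Ordinal bq)).
  by move=> qb; have -> : (b : nat) = q by have := ltn_ord b; lia.
pose D := [set tau in A | hit tau].
have AD : #|A| = #|D| + #|avoiders rho n q.+1|.
  rewrite avS -(cardsID [set tau | hit tau] A); congr (_ + _);
    by apply: eq_card => tau; rewrite !inE // andbC.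
have cover : A \subset
    [set (p.1^-1 * p.2)%g | p in finset.setX [set g | perm_on X g] D].
  apply/fintype.subsetP => tau tauA.
  have [|g gX gt] := rearrange_block rho n tau (q * K); first by rewrite -/K; lia.
  apply/imsetP; exists (g, g * tau)%g; last by rewrite /= mulKg.
  rewrite finset.in_setX !inE gX /=.
  rewrite {1}/hit gt andbT; apply/forallP => b.
  move: tauA; rewrite inE => /forallP/(_ b).
  rewrite (perm_on_fix_occurs _ _ _ _ X)// => x /andP[_ xb].
  rewrite inE negb_and -ltnNge (leq_trans xb)// -/K.
  by rewrite -mulSnr leq_mul2r ltn_ord orbT.
have AKD : #|A| <= K`! * #|D|.
  apply: leq_trans (subset_leq_card cover) _.
  apply: leq_trans (leq_imset_card _ _) _.
  by rewrite cardsX cardsE card_perm leq_mul2r leq_fact ?orbT.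
have := fact_gt0 K; nia.
Qed.

Lemma card_avoiders (rho : cpattern) n q : q * psize rho <= n.+1 ->
  (psize rho)`! ^ q * #|avoiders rho n q| <= (psize rho)`!.-1 ^ q * n.+1`!.
Proof.
elim: q => [_|q IH qn].
  by rewrite !expn0 !mul1n -card_Sn max_card.
have {}IH := IH (leq_trans (leq_mul (leqnSn q) (leqnn _)) qn).
have := card_avoiders_step rho n q qn; move: IH.
move: (psize rho)`! => F IH step; rewrite !expnSr -!mulnA.
apply: leq_trans (leq_mul (leqnn _) step) _.
by rewrite mulnCA [leqRHS]mulnCA leq_mul.
Qed.

(** * The probability of avoiding a pattern *)

Local Open Scope classical_set_scope.
Local Open Scope ring_scope.

Lemma unif_finprob_avoid_le (R : realType) (rho : cpattern) n :
  unif_finprob R [set tau : 'S_n.+1 | ~ (rho <= as_pattern tau)%O] <=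
    (1 - ((psize rho)`!%:R)^-1) ^+ (n.+1 %/ psize rho).
Proof.
set E := [set tau | _]; set K := psize rho; set q := (n.+1 %/ K)%N.
have K0 : (0 : R) < K`!%:R by rewrite ltr0n fact_gt0.
have sub : (#|[pred t | t \in E]| <= #|avoiders rho n q|)%N.
  apply/subset_leq_card/fintype.subsetP => tau; rewrite !inE => nle.
  apply/forallP => b; apply/negP => occ; apply: nle.
  by apply/cpattern_le_occurs; exists (b * K)%N.
have := card_avoiders rho n q (leq_divM _ _); rewrite -/K => cardq.
rewrite /unif_finprob card_Sn ler_pdivrMr ?ltr0n ?fact_gt0//.
apply: (@le_trans _ _ #|avoiders rho n q|%:R); first by rewrite ler_nat.
have -> : 1 - K`!%:R^-1 = K`!.-1%:R / K`!%:R :> R.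
  by rewrite -[K`!.-1]subn1 natrB ?fact_gt0// mulrBl divff ?gt_eqF// mul1r.
rewrite expr_div_n mulrAC ler_pdivlMr ?exprn_gt0// -!natrX -!natrM ler_nat mulnC.
exact: cardq.
Qed.

Lemma cvg_succ_divn (K : nat) :
  (0 < K)%N -> (fun n => (n.+1 %/ K)%N) @ \oo --> \oo.
Proof.
move=> K0 A [N _ NA]; exists (N * K)%N => // n /= Kn; apply: NA => /=.
by rewrite leq_divRL// (leq_trans Kn).
Qed.

Theorem corollary4p2 (R : realType) (sigma : cpattern) :
  (fun n : nat => unif_finprob R
     [set tau : 'S_n.+1 |
       shellable_interval sigma (existT (fun m => 'S_m.+1) n tau)])
    @ \oo --> (0 : R).
Proof.
have [s [r [sigmas s3 rL [occ0 occL] occs]]] := exists_straddled sigma.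
pose c : R := 1 - (psize r)`!%:R^-1.
have c_lt1 : `|c| < 1.
  rewrite ger0_norm.
    by rewrite ltrBlDr ltrDl invr_gt0 ltr0n fact_gt0.
  by rewrite subr_ge0 invf_le1 ?ltr0n ?fact_gt0// ler1n fact_gt0.
apply: (@squeeze_cvgr _ _ _ _ (cst 0) (fun n => c ^+ (n.+1 %/ psize r))).
- apply: nearW => n; rewrite divr_ge0//=.
  apply: le_trans (unif_finprob_avoid_le R r n).
  rewrite ler_pM2r ?invr_gt0 ?ltr0n ?card_Sn ?fact_gt0// ler_nat.
  apply/subset_leq_card/fintype.subsetP => tau; rewrite !inE => shell rtau.
  exact: straddled_not_shellable s3 rL occ0 occL occs sigmas rtau shell.
- exact: cvg_cst.
- apply: (cvg_comp _ _ (cvg_succ_divn (psize r) isT)).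
  exact: cvg_expr.
Qed.
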